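(* Let $R$ be a regular local ring of dimension at most two with field of fractions $L$ and maximal ideal $\mathfrak m_R$. Let $\mathscr D$ be a skew field, finite-dimensional over $L$, whose centre is separable over $L$, and let $\mathscr A=M_n(\mathscr D)$. If $\mathfrak m_R$ is non-principal and $R$ is complete in the $\mathfrak m_R$-adic topology, then there are no hereditary $R$-orders in $\mathscr A$.
   Context: An order is (left) hereditary if all of its left ideals are projective. *)

(* Defs.v *)
(* Subsets are boolean predicates {pred T}, as in the library; with classical
   choice these are arbitrary subsets. *)
From HB Require Import structures.
From mathcomp Require Import all_boot all_algebra all_field.

Set Implicit Arguments.
Unset Strict Implicit.
Unset Printing Implicit Defensive.

Import GRing.Theory.
Local Open Scope ring_scope.

Section Generation.
Variables (R : nzRingType) (V : lmodType R).

Definition generated_by k (v : 'I_k -> V) (S : {pred V}) : Prop :=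
  forall x, x \in S <-> exists c : 'I_k -> R, x = \sum_(i < k) c i *: v i.

Definition generated_by_card (S : {pred V}) k : Prop :=
  exists v : 'I_k -> V, generated_by v S.

Definition min_number_gens (S : {pred V}) d : Prop :=
  generated_by_card S d /\ forall k, generated_by_card S k -> (d <= k)%N.

End Generation.

Section CommutativeRings.
Variable R : comNzRingType.
Implicit Types m I J : {pred R}.

(* Submodules of the regular module R^o are the ideals, R included. *)
Definition noetherian : Prop :=
  forall I : submodClosed R^o, exists k, generated_by_card (V := R^o) I k.

(* idealr_closed is the library's notion of proper ideal. *)
Definition maximal_ideal m : Prop :=
  idealr_closed m /\
  forall J, idealr_closed J -> {subset m <= J} -> {subset J <= m}.

Definition local_with m : Prop :=
  maximal_ideal m /\ forall J, maximal_ideal J -> J =i m.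

(* prime_idealr_closed only states the primality condition. *)
Definition prime_ideal I : Prop := idealr_closed I /\ prime_idealr_closed I.

Definition prime_chain d : Prop :=
  exists P : 'I_d.+1 -> {pred R},
    (forall i, prime_ideal (P i)) /\
    (forall i j : 'I_d.+1, (i < j)%N ->
       {subset P i <= P j} /\ ~ {subset P j <= P i}).

Definition krull_dim d : Prop := prime_chain d /\ ~ prime_chain d.+1.

Definition regular_local m d : Prop :=
  [/\ noetherian, local_with m, krull_dim d
    & min_number_gens (V := R^o) m d].

Definition principal m : Prop := generated_by_card (V := R^o) m 1.

Fixpoint ideal_exp m k : R -> Prop :=
  if k is k'.+1 then
    fun x => exists r (a b : 'I_r -> R),
      [/\ forall i, a i \in m, forall i, ideal_exp m k' (b i)
        & x = \sum_(i < r) a i * b i]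
  else fun=> True.

Definition adic_complete m : Prop :=
  (forall x, (forall k, ideal_exp m k x) -> x = 0) /\
  forall u : nat -> R,
    (forall k, exists N, forall i j, (N <= i)%N -> (N <= j)%N ->
       ideal_exp m k (u i - u j)) ->
    exists l, forall k, exists N, forall i, (N <= i)%N ->
       ideal_exp m k (u i - l).

End CommutativeRings.

Definition projective (S : nzRingType) (P : lmodType S) : Prop :=
  forall (M N : lmodType S) (g : {linear M -> N}) (f : {linear P -> N}),
    (forall y, exists x, g x = y) ->
    exists h : {linear P -> M}, forall x, g (h x) = f x.

Definition submod_of (S : nzRingType) (V : lmodType S) (I : submodClosed V) :=
  {x : V | x \in I}.

Section SubmoduleInstances.
Variables (S : nzRingType) (V : lmodType S) (I : submodClosed V).
HB.instance Definition _ := SubChoice.on (submod_of I).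
HB.instance Definition _ := [SubChoice_isSubLmodule of submod_of I by <:].
End SubmoduleInstances.

Definition subring_of (A : nzRingType) (O : subringClosed A) :=
  {x : A | x \in O}.

Section SubringInstances.
Variables (A : nzRingType) (O : subringClosed A).
HB.instance Definition _ := SubChoice.on (subring_of O).
HB.instance Definition _ := [SubChoice_isSubNzRing of subring_of O by <:].
End SubringInstances.

(* lmodType is the type of left modules, so submodules of S^o are exactly the
   left ideals of S. *)
Definition left_hereditary (S : nzRingType) : Prop :=
  forall I : submodClosed S^o, projective (submod_of I).

Definition skew_field (D : unitRingType) : Prop :=
  forall x : D, x != 0 -> x \is a GRing.unit.

(* The centre of a finite-dimensional skew field, as a field extension of the
   base field. *)
Definition centre_of (K : fieldType) (D : falgType K) (hD : skew_field D) :=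
  subvs_of 'Z({:D})%AS.

Section CentreInstances.
Variables (K : fieldType) (D : falgType K) (hD : skew_field D).

HB.instance Definition _ := Falgebra.on (centre_of hD).

Fact centre_mulC : commutative (@GRing.mul (centre_of hD)).
Proof.
move=> x y; apply: val_inj => /=.
have /centvP := subvP (cent_centerv {:D}) _ (memvf (vsval x)).
by apply; apply: valP.
Qed.

HB.instance Definition _ :=
  GRing.PzRing_hasCommutativeMul.Build (centre_of hD) centre_mulC.

Fact centre_fieldP : GRing.field_axiom (centre_of hD).
Proof. by move=> x nz_x; apply: vsval_unitr; apply: hD. Qed.

HB.instance Definition _ :=
  GRing.ComUnitRing_isField.Build (centre_of hD) centre_fieldP.
End CentreInstances.

Definition separable_centre (K : fieldType) (D : falgType K)
    (hD : skew_field D) : Prop :=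
  separable 1%AS {:centre_of hD}.

Section Orders.
Variables (R : idomainType) (D : falgType {fraction R}) (n : nat).

(* {fraction R} acts on 'M[D]_n.+1 through the central scalars c%:A of D. *)
(* A subring, finitely generated as an R-module, that spans over {fraction R}. *)
Definition is_order (O : subringClosed 'M[D]_n.+1) : Prop :=
  (exists k (v : 'I_k -> 'M[D]_n.+1), forall x,
     x \in O <->
     exists c : 'I_k -> R, x = \sum_(i < k) (tofrac (c i))%:A *: v i) /\
  (forall x : 'M[D]_n.+1, exists k (v : 'I_k -> 'M[D]_n.+1),
     (forall i, v i \in O) /\
     exists c : 'I_k -> {fraction R}, x = \sum_(i < k) (c i)%:A *: v i).

End Orders.

(* Main.v *)
From HB Require Import structures.
Require Import Defs.
From mathcomp Require Import all_boot all_algebra all_field.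
From mathcomp Require Import boolp ring.

Set Implicit Arguments.
Unset Strict Implicit.
Unset Printing Implicit Defensive.

Import GRing.Theory.
Local Open Scope ring_scope.

(** Why there is no hereditary order.  Since [m] is not principal, [d] is 2 and
    [m] is generated by two elements [x] and [y].  Let [O] be a hereditary
    order in A = M_n(D).  The left ideal O x + O y is projective, so the
    surjection of O * O onto it, (b, c) |-> b x + c y, has a section
    ([hereditary_split]).  As [x] and [y] are central in A, the section is right
    multiplication by a pair of elements q, p of A, with

       1 = x q + y p   and   x q, y q, x p, y p all in O.

    Call an element v of A saturated if x^k v and y^k v lie in O for some k;
    these elements are stable under right multiplication by q and p.  Let phi
    be a coordinate of A over the fraction field, and s <> 0 a common
    denominator of phi on O.  If v is saturated then a = s phi(v) is a
    fraction with x^k a and y^k a in R, and because x, y is a regular sequence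
    a lies in R ([tofrac_extend]).  Writing v = x (v q) + y (v p) and iterating,
    s phi(v) lies in every power of m ([saturated_coord]), hence is 0 because R
    is separated for the m-adic topology.  Taking v = 1, and phi with
    phi(1) <> 0, gives a contradiction ([order_not_hereditary]).

    What remains is that x, y is a regular sequence.  If y^j s is in x R for a
    unit s then y is nilpotent modulo x, so that R/xR is uniserial of finite
    length.  This is impossible when there is a prime ideal P strictly between
    0 and m: the argument is the one of Krull's principal ideal theorem
    ([pow_notin_multiples]).  Therefore N, the ideal of all s with y^j s in x R
    for some j, is proper; every element of N has the form a x + b y, and then
    b is in N, so N = x R + y N, and N = x R by Nakayama's lemma
    ([regular_sequence]).  Both uses of Nakayama's lemma need 1 - t to be a unit
    for every t in m, which follows from completeness by the geometric series. *)

(** * Ideals and Nakayama's lemma *)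

Section Ideals.
Variable R : comNzRingType.
Implicit Types I J N : R -> Prop.

(** Propositional predicates, with no requirement of being proper, so that
    saturations and sums of ideals can be written down directly. *)
Definition ideal I := I 0 /\ forall a u v, I u -> I v -> I (a * u + v).

Lemma ideal0 I : ideal I -> I 0. Proof. by case. Qed.

Lemma idealD I u v : ideal I -> I u -> I v -> I (u + v).
Proof. by case=> _ H Iu Iv; rewrite -[u]mul1r; apply: H. Qed.

Lemma idealM I a u : ideal I -> I u -> I (a * u).
Proof. by case=> I0 H Iu; rewrite -[_ * _]addr0; apply: H. Qed.

Lemma idealB I u v : ideal I -> I u -> I v -> I (u - v).
Proof.
by move=> iI Iu Iv; rewrite -mulN1r addrC; case: iI => _; apply.
Qed.

Lemma ideal_sum I k (c v : 'I_k -> R) :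
  ideal I -> (forall i, I (v i)) -> I (\sum_(i < k) c i * v i).
Proof.
move=> iI Iv; elim/big_ind: _ => [|u w|i _]; first exact: ideal0.
  exact: idealD.
exact: idealM.
Qed.

Definition multiples (x r : R) := exists t, r = x * t.

Lemma multiples_ideal x : ideal (multiples x).
Proof.
split=> [|a _ _ [s ->] [t ->]]; first by exists 0; rewrite mulr0.
by exists (a * s + t); ring.
Qed.

Lemma idealr_closed_ideal (m : {pred R}) :
  idealr_closed m -> ideal (fun r => r \in m).
Proof. by case=> m0 _ mD; split=> // a u v; apply: mD. Qed.

Section Generators.
Variables (I : R -> Prop) (iI : ideal I).

Fact ideal_subsemimod_closed :
  GRing.subsemimod_closed (fun r : R^o => `[< I r >]).
Proof.
split; first split.
- by apply/asboolP/(ideal0 iI).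
- by move=> u v /asboolP Iu /asboolP Iv; apply/asboolP/(idealD iI Iu Iv).
- by move=> a u /asboolP Iu; apply/asboolP/(idealM a iI Iu).
Qed.

Lemma noetherian_gens : noetherian R ->
  exists k (v : 'I_k -> R), (forall i, I (v i)) /\
    forall r, I r -> exists c : 'I_k -> R, r = \sum_(i < k) c i * v i.
Proof.
pose S := HB.pack_for (submodClosed R^o) (fun r : R^o => `[< I r >])
  (GRing.isSubmodClosed.Build R R^o _ ideal_subsemimod_closed).
case/(_ S) => k [v genv]; exists k, v; split=> [i | r Ir].
  suff /genv/asboolP : exists c : 'I_k -> R, v i = \sum_(j < k) c j *: v j by [].
  exists (fun j => (j == i)%:R); rewrite (bigD1 i) //= eqxx scale1r.
  by rewrite big1 ?addr0 // => j /negPf ->; rewrite scale0r.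
by apply/genv/asboolP.
Qed.

End Generators.
End Ideals.

Section Nakayama.
Variables (R : comUnitRingType) (t : R).
Hypothesis t_rad : forall c, 1 - t * c \is a GRing.unit.

(** Elimination of the last generator: modulo [N] its relation reads
    (1 - t c) v_last = t * (combination of the other ones), and 1 - t c is a
    unit, so substitution leaves relations of the same form between fewer
    generators. *)
Lemma nakayama_gens (N : R -> Prop) k (v : 'I_k -> R) : ideal N ->
  (forall i, exists c : 'I_k -> R, N (v i - t * \sum_(j < k) c j * v j)) ->
  forall i, N (v i).
Proof.
move=> iN; elim: k => [|k IHk] in v * => [_ [] //|rel].
have [c Nc] := rel ord_max; set w := fun j : 'I_k => v (widen_ord (leqnSn k) j).
set u := (1 - t * c ord_max)^-1.
pose b j := u * c (widen_ord (leqnSn k) j).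
have N_last : N (v ord_max - t * \sum_(j < k) b j * w j).
  have -> : \sum_(j < k) b j * w j =
      u * \sum_(j < k) c (widen_ord (leqnSn k) j) * w j.
    by rewrite mulr_sumr; apply: eq_bigr => j _; rewrite mulrA.
  have := idealM u iN Nc; rewrite big_ord_recr /=.
  set s := \sum_(j < k) _; have e : u * (1 - t * c ord_max) = 1 by exact: mulVr.
  congr N; rewrite -[v ord_max in RHS]mul1r -e; ring.
have Nw : forall j, N (w j).
  apply: IHk => i; have [a Na] := rel (widen_ord (leqnSn k) i).
  exists (fun j => a (widen_ord (leqnSn k) j) + a ord_max * t * b j).
  move: Na; rewrite big_ord_recr /=.
  have -> : \sum_(j < k) (a (widen_ord (leqnSn k) j) + a ord_max * t * b j) * w j
     = \sum_(j < k) a (widen_ord (leqnSn k) j) * w j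
       + a ord_max * t * \sum_(j < k) b j * w j.
    rewrite mulr_sumr -big_split; apply: eq_bigr => j _ /=; ring.
  rewrite -/w => /(idealD iN (idealM (t * a ord_max) iN N_last)).
  congr N; rewrite /w; ring.
have N_max : N (v ord_max).
  rewrite -(subrK (t * \sum_(j < k) b j * w j) (v ord_max)).
  apply: (idealD iN) => //; apply: (idealM _ iN); exact: ideal_sum.
move=> i; have [->//|lt_ik] := eqVneq i ord_max.
have lt_i : (i < k)%N.
  rewrite ltn_neqAle -ltnS ltn_ord andbT.
  by apply: contra lt_ik => /eqP e; apply/eqP/val_inj.
by have := Nw (Ordinal lt_i); congr N; congr v; apply: val_inj.
Qed.

(** Nakayama's lemma for the quotient of [I] by [N], in the form in which a single
    element [t] of the radical carries the hypothesis: [I] is contained in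
    N + t I. *)
Lemma nakayama (N I : R -> Prop) : noetherian R -> ideal N -> ideal I ->
  (forall r, I r -> exists2 s, I s & N (r - t * s)) ->
  forall r, I r -> N r.
Proof.
move=> noethR iN iI rel r Ir.
have [k [v [Iv gen]]] := noetherian_gens iI noethR.
have [c ->] := gen r Ir; apply: ideal_sum => // i.
apply: (nakayama_gens (v := v)) => // j; have [s Is Ns] := rel _ (Iv j).
by have [a Ea] := gen s Is; exists a; rewrite -Ea.
Qed.

End Nakayama.

(** * Adically complete rings *)

Section AdicallyComplete.
Variables (R : comUnitRingType) (m : {pred R}).
Hypotheses (max_m : maximal_ideal m) (complR : adic_complete m).

Let iM : ideal (fun r => r \in m).
Proof. by apply: idealr_closed_ideal; case: max_m. Qed.

Lemma ideal_exp_ideal k : ideal (ideal_exp m k).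
Proof.
case: k => [|k] //=; split.
  exists 0, (fun=> 0), (fun=> 0); split; [by case|by case|by rewrite big_ord0].
move=> c _ _ [r [a [b [ma eb ->]]]] [r' [a' [b' [ma' eb' ->]]]].
exists (r + r')%N.
exists (fun i => match split i with inl j => c * a j | inr j => a' j end).
exists (fun i => match split i with inl j => b j | inr j => b' j end).
split=> [i|i|]; try by case: (split i) => j //; apply: (idealM c iM).
rewrite big_split_ord mulr_sumr; congr (_ + _); apply: eq_bigr => i _.
  by rewrite (unsplitK (inl i : 'I_r + 'I_r')) mulrA.
by rewrite (unsplitK (inr i : 'I_r + 'I_r')).
Qed.

Lemma ideal_expS x k r : x \in m -> ideal_exp m k r -> ideal_exp m k.+1 (x * r).
Proof.
by move=> mx er; exists 1, (fun=> x), (fun=> r); split; rewrite ?big_ord1.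
Qed.

(** The inverse is the limit of the geometric series; [u i] is the sum of its
    first [i] terms, defined by Horner's rule. *)
Lemma one_sub_unit x : x \in m -> 1 - x \is a GRing.unit.
Proof.
move=> mx; pose u i := iter i (fun s => 1 + x * s) 0.
have u_cauchy k i j : (k <= i)%N -> (k <= j)%N -> ideal_exp m k (u i - u j).
  elim: k i j => [|k IHk] // [|i] [|j] // ki kj.
  have -> : u i.+1 - u j.+1 = x * (u i - u j) by rewrite /u /=; ring.
  exact: ideal_expS (IHk _ _ _ _).
case: complR => sep /(_ u) [k|l lim_u].
  by exists k => i j; apply: u_cauchy.
suff e : (1 - x) * l - 1 = 0.
  apply/unitrP; exists l; move/subr0_eq: e => e; split=> //.
  by rewrite mulrC.
apply: sep => k; have [M lim] := lim_u k.
have -> : (1 - x) * l - 1 = x * (u M - l) - (u M.+1 - l).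
  by rewrite /u /=; ring.
have iE := ideal_exp_ideal k.
by apply: idealB; [| apply: idealM => //; apply: lim | apply: lim].
Qed.

(** By maximality the ideal generated by [m] and [r] contains 1, so a multiple
    of [r] is of the form 1 - t with t in [m]. *)
Lemma notin_max_unit r : r \notin m -> r \is a GRing.unit.
Proof.
move=> nmr; pose J := [pred s : R | `[< exists c, s - c * r \in m >]].
have Jr : r \in J.
  by apply/asboolP; exists 1; rewrite mul1r subrr; apply: (ideal0 iM).
have mJ : {subset m <= J}.
  by move=> s ms; apply/asboolP; exists 0; rewrite mul0r subr0.
have [J1|nJ1] := boolP (1 \in J); last first.
  case: max_m => _ /(_ J) H; case/negP: nmr; apply: H => //; split=> //.
    by apply: mJ; apply: (ideal0 iM).
  move=> a u v /asboolP [c mc] /asboolP [e me]; apply/asboolP.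
  exists (a * c + e).
  have -> : a * u + v - (a * c + e) * r = a * (u - c * r) + (v - e * r) by ring.
  by case: iM => _; apply.
case/asboolP: J1 => c /one_sub_unit; rewrite subKr unitrM.
by case/andP.
Qed.

End AdicallyComplete.

(** * Two generators of the maximal ideal form a regular sequence *)

(** [z] and [w] witness that the prime [P] lies strictly between 0 and [m]. *)
Section DimensionTwo.
Variables (R : idomainType) (m : {pred R}) (x y : R) (P : {pred R}) (z w : R).
Hypotheses (noethR : noetherian R) (max_m : maximal_ideal m).
Hypothesis complR : adic_complete m.
Hypothesis genm : forall r, r \in m <-> exists a b, r = a * x + b * y.
Hypotheses (primeP : prime_ideal P) (Pz : z \in P) (nz_z : z != 0).
Hypotheses (mw : w \in m) (Pw : w \notin P).

Let iP : ideal (fun r => r \in P).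
Proof. by apply: idealr_closed_ideal; case: primeP. Qed.

Let iM : ideal (fun r => r \in m).
Proof. by apply: idealr_closed_ideal; case: max_m. Qed.

Let mx : x \in m.
Proof. by apply/genm; exists 1, 0; rewrite mul1r mul0r addr0. Qed.

Let my : y \in m.
Proof. by apply/genm; exists 0, 1; rewrite mul1r mul0r add0r. Qed.

Let radical t : t \in m -> forall c, 1 - t * c \is a GRing.unit.
Proof.
by move=> mt c; apply: (one_sub_unit max_m complR); rewrite mulrC (idealM c iM).
Qed.

Let notinPM r s : r \notin P -> s \notin P -> r * s \notin P.
Proof.
move=> Pr Ps; apply/negP => /(proj2 primeP _ _).
by rewrite (negPf Pr) (negPf Ps).
Qed.

(** Modulo [x] the maximal ideal is generated by [y], so an element is either a
    unit times a power of [y], or divisible by an arbitrarily high one. *)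
Lemma uniserial_mod j r :
  (exists i u t, [/\ (i < j)%N, u \is a GRing.unit & r = u * y ^+ i + x * t]) \/
  (exists s t, r = y ^+ j * s + x * t).
Proof.
elim: j => [|j [[i [u [t [lt_ij Uu ->]]]]|[s [t ->]]]].
- by right; exists r, 0; rewrite mul1r mulr0 addr0.
- by left; exists i, u, t; split=> //; apply: leqW.
have [/genm [a [b ->]]|/(notin_max_unit max_m complR) Us] := boolP (s \in m).
  right; exists b, (y ^+ j * a + t); rewrite exprSr; ring.
by left; exists j, s, t; split=> //; rewrite mulrC.
Qed.

(** This is the proof of Krull's principal ideal theorem.  If y^k is in x R then
    [x] is not in [P].  Let J_n be the contraction to R of the ideal generated
    by z^n in the localization at [P]; as [x] is outside [P], x r in J_n implies
    r in J_n.  If J_n were contained in J_(n+1) + x R it would be contained in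
    J_(n+1) + x J_n, hence in J_(n+1) by Nakayama, and then z^n in J_(n+1) would
    yield an element outside [P] which is a multiple of [z].  So the ideals
    J_n + x R decrease strictly, whereas R/xR, where [y] is nilpotent, has only
    finitely many ideals: they are generated by powers of [y]. *)
Lemma pow_notin_multiples k : ~ multiples x (y ^+ k).
Proof.
move=> [t0 Et0].
have Px : x \notin P.
  apply: contra Pw => Px; have /genm [a [b ->]] := mw.
  apply: (idealD iP); apply: (idealM _ iP) => //.
  have : y ^+ k \in P by rewrite Et0 mulrC (idealM _ iP).
  elim: k {Et0} => [|k IHk].
    by move=> P1; case: primeP => [[_]]; rewrite -(expr0 y) P1.
  by rewrite exprS => /(proj2 primeP _ _) /orP [].
(* z^n R_P intersected with R *)
pose J n r := exists2 s, s \notin P & multiples (z ^+ n) (s * r).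
have iJ n : ideal (J n).
  split=> [|a u v [s Ps [c Ec]] [s' Ps' [c' Ec']]].
    exists 1; first by case: primeP => [[_]].
    by exists 0; rewrite !mulr0.
  exists (s * s'); first exact: notinPM.
  exists (a * s' * c + s * c').
  rewrite mulrDr mulrDr.
  have -> : z ^+ n * (a * s' * c) = a * s' * (z ^+ n * c) by ring.
  have -> : z ^+ n * (s * c') = s * (z ^+ n * c') by ring.
  by rewrite -Ec -Ec'; ring.
have J_sat n r : J n (x * r) -> J n r.
  case=> s Ps [c Ec]; exists (s * x); first exact: notinPM.
  by exists c; rewrite -Ec mulrA.
have J_decr n r : J n.+1 r -> J n r.
  by case=> s Ps [c Ec]; exists s => //; exists (z * c); rewrite Ec exprSr mulrA.
have J_pow n : ~ J n.+1 (z ^+ n).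
  case=> s Ps [c]; rewrite exprSr mulrC -mulrA.
  move/(mulfI (expf_neq0 n nz_z)) => Es.
  by case/negP: Ps; rewrite Es mulrC (idealM _ iP).
pose Jx n r := exists2 s, J n s & multiples x (r - s).
have iX := multiples_ideal x.
have iJx n : ideal (Jx n).
  split=> [|a u v [s Js xs] [s' Js' xs']].
    by exists 0; rewrite ?subr0; [apply: (ideal0 (iJ n)) | apply: (ideal0 iX)].
  exists (a * s + s'); first by case: (iJ n) => _; apply.
  have -> : a * u + v - (a * s + s') = a * (u - s) + (v - s') by ring.
  by case: iX => _; apply.
have Jx_mult n c : Jx n (x * c).
  by exists 0; [apply: (ideal0 (iJ n)) | exists c; rewrite subr0].
have strict n : exists2 r, J n r & ~ Jx n.+1 r.
  apply: contrapT => sub; apply: (J_pow n).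
  apply: (nakayama (radical mx) (I := J n)) => // [r Jr|].
    have [s Js [c Ec]] : Jx n.+1 r by apply: contrapT => nJ; apply: sub; exists r.
    exists c; last by rewrite -Ec subKr.
    by apply: J_sat; rewrite -Ec; apply: (idealB (iJ n)) => //; apply: J_decr.
  by exists 1; [case: primeP => [[_]] | exists 1; rewrite mulrC].
(* The least exponent of a power of y in J_n + x R grows with n. *)
have low n : forall i, Jx n (y ^+ i) -> (n <= i)%N.
  elim: n => // n IHn i Ji; have [r Jr nJr] := strict n.
  case: (uniserial_mod k r) => [[j [u [t [lt_jk Uu Er]]]]|[s [t Er]]]; last first.
    case: nJr; rewrite Er Et0 -mulrA -mulrDr; exact: Jx_mult.
  have le_nj : (n <= j)%N.
    apply: IHn; exists (u^-1 * r); first exact: (idealM _ (iJ n)).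
    exists (- (u^-1 * t)); rewrite Er mulrDr mulKr //; ring.
  apply: leq_ltn_trans le_nj _; rewrite ltnNge; apply/negP => le_ij.
  apply: nJr; rewrite Er; apply: (idealD (iJx _)) => //.
  by rewrite -(subnK le_ij) exprD mulrA; apply: (idealM _ (iJx _)).
suff : (k.+1 <= k)%N by rewrite ltnn.
by apply: low; rewrite Et0; apply: Jx_mult.
Qed.

(** [N] is the saturation of x R by powers of [y]; by the previous lemma it
    contains no unit. *)
Lemma regular_sequence r : multiples x (y * r) -> multiples x r.
Proof.
move=> xyr; pose N r := exists j, multiples x (y ^+ j * r).
have iX := multiples_ideal x.
have iN : ideal N.
  split=> [|a u v [i xu] [j xv]].
    by exists 0%N; rewrite mulr0; apply: (ideal0 iX).
  exists (i + j)%N.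
  have -> : y ^+ (i + j) * (a * u + v) =
      (a * y ^+ j) * (y ^+ i * u) + y ^+ i * (y ^+ j * v) by rewrite exprD; ring.
  by apply: (idealD iX); apply: (idealM _ iX).
apply: (nakayama (radical my) (I := N)) => // [s [j xs]|]; last first.
  by exists 1%N; rewrite expr1.
have /genm [a [b Es]] : s \in m.
  apply: contrapT => /negP /(notin_max_unit max_m complR) Us.
  apply: (@pow_notin_multiples j).
  by rewrite -(mulrK Us (y ^+ j)) mulrC; apply: (idealM _ iX).
exists b; last by exists a; rewrite Es; ring.
exists j.+1; case: xs => c Ec; exists (c - y ^+ j * a).
rewrite mulrBr -Ec Es exprSr; ring.
Qed.

Hypothesis nz_x : x != 0.

Lemma regular_pow k r s : y ^+ k * r = x ^+ k * s -> multiples (x ^+ k) r.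
Proof.
have drop i u : multiples x (y ^+ i * u) -> multiples x u.
  elim: i => [|i IHi]; first by rewrite mul1r.
  by rewrite exprS -mulrA => /regular_sequence /IHi.
suff gen l : y ^+ k * r = x ^+ l * s -> multiples (x ^+ l) r by exact: gen.
elim: l r s => [|l IHl] r s E; first by exists r; rewrite mul1r.
have [|r' Er] := drop k r; first by exists (x ^+ l * s); rewrite E exprS mulrA.
have [|t Et] := IHl r' s.
  apply: (mulfI nz_x); rewrite [RHS]mulrA -exprS -E Er; ring.
by exists t; rewrite Er Et exprS mulrA.
Qed.

(** R has depth at least two: a fraction whose products with x^k and y^k
    are both in R is in R. *)
Lemma tofrac_extend (a : {fraction R}) k r s :
  tofrac (x ^+ k) * a = tofrac r -> tofrac (y ^+ k) * a = tofrac s ->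
  exists c, a = tofrac c.
Proof.
move=> Er Es; have nzx : tofrac (x ^+ k) != 0 by rewrite tofrac_eq0 expf_neq0.
have [|c Ec] := @regular_pow k r s.
  apply/eqP; rewrite -tofrac_eq !tofracM -Er -Es; apply/eqP; ring.
by exists c; apply: (mulfI nzx); rewrite Er Ec tofracM.
Qed.

End DimensionTwo.

(** * Splitting a two-generated left ideal *)

Section HereditarySplitting.
Variables (S : nzRingType) (x y : S).

Definition left_span2 (a : S) := exists b c, a = b * x + c * y.

Fact left_span2_subsemimod_closed :
  GRing.subsemimod_closed (fun a : S^o => `[< left_span2 a >]).
Proof.
split; first split.
- by apply/asboolP; exists 0, 0; rewrite !mul0r addr0.
- move=> _ _ /asboolP [b [c ->]] /asboolP [b' [c' ->]]; apply/asboolP.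
  by exists (b + b'), (c + c'); rewrite !mulrDl addrACA.
- move=> a _ /asboolP [b [c ->]]; apply/asboolP; exists (a * b), (a * c).
  by rewrite /GRing.scale /= mulrDr !mulrA.
Qed.

(** Projectivity of I = S x + S y splits the map (b, c) |-> b x + c y from S * S
    onto I.  The pairs (f1, g1) and (f2, g2) are the images of x and y under a
    section h.  The last two equations hold since y h(x) = h(y x) and
    x h(y) = h(x y) agree. *)
Lemma hereditary_split : left_hereditary S -> x * y = y * x ->
  exists f1 g1 f2 g2, [/\ x = f1 * x + g1 * y, y = f2 * x + g2 * y,
    y * f1 = x * f2 & y * g1 = x * g2].
Proof.
pose I := HB.pack_for (submodClosed S^o) (fun a : S^o => `[< left_span2 a >])
  (GRing.isSubmodClosed.Build S S^o _ left_span2_subsemimod_closed).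
move=> /(_ I) projI xyC.
have inI (p : S^o * S^o) : (p.1 * x + p.2 * y : S^o) \in I.
  by apply/asboolP; exists p.1, p.2.
pose mkI (a : S^o) (Ia : a \in I) : submod_of I := exist _ a Ia.
pose g (p : S^o * S^o) : submod_of I := mkI _ (inI p).
have g_lin : linear g.
  move=> a [b c] [b' c']; apply: val_inj.
  rewrite linearP !/= /GRing.scale /= !mulrDl mulrDr -!mulrA.
  by rewrite addrACA.
pose gL := HB.pack_for {linear (S^o * S^o)%type -> submod_of I} g
  (GRing.isLinear.Build S (S^o * S^o)%type (submod_of I) _ g g_lin).
have g_onto a : exists p, gL p = a.
  have /asboolP [b [c Ea]] := valP a; exists (b, c); apply: val_inj.
  by rewrite Ea.
have [h hK] := projI _ _ gL idfun g_onto.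
have Ix : (x : S^o) \in I by apply/asboolP; exists 1, 0; rewrite mul1r mul0r addr0.
have Iy : (y : S^o) \in I by apply/asboolP; exists 0, 1; rewrite mul1r mul0r add0r.
pose xI : submod_of I := mkI _ Ix; pose yI : submod_of I := mkI _ Iy.
have h_comm : y *: h xI = x *: h yI.
  have e : y *: xI = x *: yI by apply: val_inj; rewrite !linearZ /= /GRing.scale /=.
  have := congr1 h e; rewrite !linearZ => E. exact: E.
exists (h xI).1, (h xI).2, (h yI).1, (h yI).2; split.
- by have /(congr1 val) := hK xI; move=> /esym.
- by have /(congr1 val) := hK yI; move=> /esym.
- exact: (congr1 fst h_comm).
- exact: (congr1 snd h_comm).
Qed.

End HereditarySplitting.

(** * Denominators *)

Section Denominators.
Variable R : idomainType.

Lemma denominator (a : {fraction R}) :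
  exists2 s, s != 0 & exists c, tofrac s * a = tofrac c.
Proof.
elim/quotW: a => -[[p q] /= nz_q]; exists q => //; exists p.
unlock tofrac; rewrite -[LHS]FracField.pi_mul; apply/eqmodP.
rewrite /= FracField.equivfE /FracField.mulf !numden_Ratio ?mul1r ?oner_eq0 //=.
by rewrite mulr1.
Qed.

Lemma common_denominator k (a : 'I_k -> {fraction R}) :
  exists2 s, s != 0 & forall i, exists c, tofrac s * a i = tofrac c.
Proof.
have den i := cid2 (denominator (a i)); pose s i := s2val (den i).
exists (\prod_i s i) => [|i].
  by apply/prodf_neq0 => j _; exact: (s2valP (den j)).
have [c Ec] := s2valP' (den i).
exists (c * \prod_(j | j != i) s j).
by rewrite (bigD1 i) //= !tofracM mulrAC Ec.
Qed.

End Denominators.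

(** * Matrices over a finite-dimensional algebra *)

Section FractionalScalars.
Variables (L : fieldType) (D : falgType L) (n : nat).
Implicit Types (c : L) (u v : 'M[D]_n.+1).

(** Scaling by [D] commutes with right multiplications only; restricted to the
    central subfield [L] it commutes with left multiplications too, and makes
    the matrix ring an algebra over [L]. *)
Definition act c v := c%:A *: v.

Lemma actA c e v : act c (act e v) = act (c * e) v.
Proof. by rewrite /act scalerA -scalerAl mul1r scalerA. Qed.

Lemma act1 v : act 1 v = v.
Proof. by rewrite /act !scale1r. Qed.

Lemma actD c u v : act c (u + v) = act c u + act c v.
Proof. exact: scalerDr. Qed.

Lemma actMl c u v : act c (u * v) = act c u * v.
Proof. exact: scalerAl. Qed.

Lemma actMr c u v : act c (u * v) = u * act c v.
Proof.
apply/matrixP => i j; rewrite !mxE mulr_sumr; apply: eq_bigr => k _.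
by rewrite !mxE !mulr_algl scalerAr.
Qed.

Definition entry_coord b v : L := coord (vbasis {:D}) b (v 0 0).

Lemma entry_coordZ b c v : entry_coord b (act c v) = c * entry_coord b v.
Proof. by rewrite /entry_coord !mxE mulr_algl linearZ. Qed.

Lemma entry_coordD b u v : entry_coord b (u + v) = entry_coord b u + entry_coord b v.
Proof. by rewrite /entry_coord !mxE linearD. Qed.

Lemma entry_coord_sum b k (v : 'I_k -> 'M[D]_n.+1) :
  entry_coord b (\sum_(i < k) v i) = \sum_(i < k) entry_coord b (v i).
Proof. by rewrite /entry_coord summxE linear_sum. Qed.

Lemma entry_coord1 : exists b, entry_coord b 1 != 0.
Proof.
apply: contrapT => none; have /eqP := oner_neq0 D; apply.
have E : (1 : 'M[D]_n.+1) 0 0 = 1 by rewrite mxE eqxx.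
rewrite -E [LHS](coord_vbasis (memvf _)) big1 // => b _.
suff -> : coord (vbasis {:D}) b ((1 : 'M[D]_n.+1) 0 0) = 0 by rewrite scale0r.
by apply: contrapT => /eqP nz; apply: none; exists b.
Qed.

End FractionalScalars.

(** * Orders over a complete ring of depth two *)

Section NoHereditaryOrder.
Variables (R : idomainType) (m : {pred R}) (x y : R).
Variables (D : falgType {fraction R}) (n : nat).
Hypotheses (max_m : maximal_ideal m) (complR : adic_complete m).
Hypotheses (mx : x \in m) (my : y \in m) (nz_x : x != 0).
Hypothesis extend : forall (a : {fraction R}) k r s,
  tofrac (x ^+ k) * a = tofrac r -> tofrac (y ^+ k) * a = tofrac s ->
  exists c, a = tofrac c.
Variable O : subringClosed 'M[D]_n.+1.
Hypothesis orderO : is_order O.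

Local Notation X := (tofrac x).
Local Notation Y := (tofrac y).

Lemma order_act r v : v \in O -> act (tofrac r) v \in O.
Proof.
case: orderO => -[k [g gen]] _ /gen [c ->]; apply/gen.
exists (fun i => r * c i); rewrite /act scaler_sumr; apply: eq_bigr => i _.
by have := actA (tofrac r) (tofrac (c i)) (g i); rewrite /act -tofracM.
Qed.

(** The intersection of O[1/x] and O[1/y]. *)
Definition saturated v :=
  exists k, act (tofrac (x ^+ k)) v \in O /\ act (tofrac (y ^+ k)) v \in O.

Lemma order_coord b : exists2 s, s != 0 &
  forall v, v \in O -> exists r, tofrac s * entry_coord b v = tofrac r.
Proof.
case: orderO => -[k [g gen]] _.
have [s nz_s den] := common_denominator (fun i => entry_coord b (g i)).
exists s => // v /gen [c ->].
have /choice [e Ee] : forall i, exists e, tofrac s * entry_coord b (g i) = tofrac e.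
  exact: den.
exists (\sum_(i < k) c i * e i).
rewrite entry_coord_sum mulr_sumr rmorph_sum; apply: eq_bigr => i _.
by rewrite entry_coordZ mulrCA Ee -tofracM.
Qed.

(** Let phi be [entry_coord b].  For k = 0, [extend] applies to the fraction
    s phi(v).  From k to k + 1,
    v = x (v q) + y (v p) where v q and v p are again saturated: for instance
    x^(k+1) (v q) = (x^k v) (x q) is a product of two elements of O. *)
Lemma saturated_coord p q b s :
  1 = act X q + act Y p ->
  [/\ act X q \in O, act Y q \in O, act X p \in O & act Y p \in O] ->
  (forall v, v \in O -> exists r, tofrac s * entry_coord b v = tofrac r) ->
  forall k v, saturated v ->
    exists2 r, ideal_exp m k r & tofrac s * entry_coord b v = tofrac r.
Proof.
move=> E1 [OXq OYq OXp OYp] den.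
have sat_mul v u :
    act X u \in O -> act Y u \in O -> saturated v -> saturated (v * u).
  move=> OXu OYu [k [OXv OYv]]; exists k.+1.
  have step t : act (tofrac (t ^+ k)) v \in O -> act (tofrac t) u \in O ->
      act (tofrac (t ^+ k.+1)) (v * u) \in O.
    move=> Ov Ou.
    by rewrite exprS tofracM -actA actMl actMr; exact: rpredM.
  by split; apply: step.
elim=> [|k IHk] v sat_v.
  have [k [OXv OYv]] := sat_v.
  have [r Er] := den _ OXv; have [t Et] := den _ OYv.
  have [||c Ec] := @extend (tofrac s * entry_coord b v) k r t.
  - by rewrite -Er entry_coordZ mulrCA.
  - by rewrite -Et entry_coordZ mulrCA.
  by exists c.
have [r1 e1 E1r] := IHk (v * q) (sat_mul _ _ OXq OYq sat_v).
have [r2 e2 E2r] := IHk (v * p) (sat_mul _ _ OXp OYp sat_v).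
exists (x * r1 + y * r2).
  by apply: (idealD (ideal_exp_ideal max_m k.+1)); apply: ideal_expS.
rewrite -[v]mulr1 E1 mulrDr -!actMr entry_coordD !entry_coordZ.
by rewrite tofracD !tofracM -E1r -E2r mulrDr mulrCA [X in _ + X]mulrCA.
Qed.

(** The section supplied by [hereditary_split] is right multiplication by
    q = f1 / x and p = g1 / x: the elements y q and y p are in O since they are
    f2 and g2, and dividing x = f1 x + g1 y by x gives 1 = x q + y p. *)
Lemma order_not_hereditary : ~ left_hereditary (subring_of O).
Proof.
move=> herO.
have Oscal r : act (tofrac r) 1 \in O by apply: order_act; apply: rpred1.
pose hat r : subring_of O :=
  exist (fun v : 'M[D]_n.+1 => v \in O) _ (Oscal r).
have hatMr r (a : subring_of O) : val (a * hat r) = act (tofrac r) (val a).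
  by rewrite rmorphM /= -actMr mulr1.
have hatMl r (a : subring_of O) : val (hat r * a) = act (tofrac r) (val a).
  by rewrite rmorphM /= -actMl mul1r.
have hatC : hat x * hat y = hat y * hat x.
  by apply: val_inj; rewrite hatMr hatMl.
have [f1 [g1 [f2 [g2 [Ex _ Ef Eg]]]]] := hereditary_split herO hatC.
have nzX : X != 0 by rewrite tofrac_eq0.
pose q := act X^-1 (val f1); pose p := act X^-1 (val g1).
have XK v : act X (act X^-1 v) = v by rewrite actA divff // act1.
have YK f g : hat y * f = hat x * g -> act Y (act X^-1 (val f)) = val g.
  move/(congr1 val); rewrite !hatMl => E.
  by rewrite actA mulrC -actA E actA mulVf // act1.
have E1 : 1 = act X q + act Y p.
  have : act X 1 = act X (val f1) + act Y (val g1).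
    by rewrite -!hatMr -rmorphD -Ex.
  move/(congr1 (act X^-1)); rewrite actA mulVf // act1 => {1}->.
  by rewrite actD !actA mulrC (mulrC X^-1).
have OXYqp : [/\ act X q \in O, act Y q \in O, act X p \in O & act Y p \in O].
  by rewrite /q /p !XK (YK _ _ Ef) (YK _ _ Eg); split; exact: valP.
have [b nz_b] := entry_coord1 D n.
have [s nz_s den] := order_coord b.
have sat1 : saturated 1.
  by exists 0%N; rewrite !expr0 tofrac1 !act1; split; apply: rpred1.
have coord1 k := saturated_coord E1 OXYqp den k sat1.
have [r _ Er] := coord1 0%N.
have r0 : r = 0.
  case: complR => sep _; apply: sep => k; have [t et Et] := coord1 k.
  suff -> : r = t by [].
  by apply/eqP; rewrite -tofrac_eq -Er -Et.
by move/eqP: Er; rewrite r0 tofrac0 mulf_eq0 (negPf nz_b) tofrac_eq0 (negPf nz_s).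
Qed.

End NoHereditaryOrder.

Theorem corollary2p32 (R : idomainType) (m : {pred R}) (d : nat)
    (regR : regular_local m d) (dim_le2 : (d <= 2)%N)
    (D : falgType {fraction R}) (hD : skew_field D)
    (sepZ : separable_centre hD) (n : nat)
    (m_nonprincipal : ~ principal m) (complR : adic_complete m) :
  ~ exists O : subringClosed 'M[D]_n.+1,
      is_order O /\ left_hereditary (subring_of O).
Proof.
case: regR => noethR [max_m _] [chain _] [[g gen] _].
have iM : ideal (fun r => r \in m) by apply: idealr_closed_ideal; case: max_m.
have d2 : d = 2%N.
  case: d dim_le2 g gen {chain} => [|[|[|]]] // _ g gen; case: m_nonprincipal.
    exists (fun=> 0) => r; split=> [/gen [c ->]|[c ->]].
      by exists (fun=> 0); rewrite big_ord0 big_ord1 scaler0.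
    by rewrite big_ord1 scaler0; apply: (ideal0 iM).
  by exists g.
subst d; pose x := g ord0; pose y := g (lift ord0 ord0).
have genm r : r \in m <-> exists a b, r = a * x + b * y.
  split=> [/gen [c ->]|[a [b ->]]].
    by rewrite !big_ord_recl big_ord0 addr0; do 2 eexists.
  apply/gen; exists (fun i => if i == ord0 then a else b).
  by rewrite !big_ord_recl big_ord0 addr0.
have mx : x \in m by apply/genm; exists 1, 0; rewrite mul1r mul0r addr0.
have my : y \in m by apply/genm; exists 0, 1; rewrite mul1r mul0r add0r.
have nz_x : x != 0.
  apply/eqP => x0; case: m_nonprincipal; exists (fun=> y) => r.
  split=> [/genm [a [b ->]]|[c ->]].
    by exists (fun=> b); rewrite big_ord1 x0 mulr0 add0r.
  by rewrite big_ord1; apply: (idealM _ iM).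
case: chain => P [primeP ltP].
(* The middle term of a chain of primes of length 2 is neither 0 nor m. *)
pose i1 : 'I_3 := lift ord0 ord0; pose i2 : 'I_3 := lift ord0 (lift ord0 ord0).
have [_ nP10] := ltP ord0 i1 isT; have [_ nP21] := ltP i1 i2 isT.
have sP2m : {subset P i2 <= m}.
  move=> r Pr; apply: contrapT => /negP /(notin_max_unit max_m complR) Ur.
  have [[P0 /negP P1 PD] _] := primeP i2; apply: P1.
  by rewrite -(mulVr Ur) -[_ * r]addr0; apply: PD.
have [z Pz nz_z] : exists2 z, z \in P i1 & z != 0.
  apply: contrapT => none; apply: nP10 => r Pr; suff -> : r = 0.
    by have [[]] := primeP ord0.
  by apply: contrapT => /eqP nz_r; apply: none; exists r.
have [w mw Pw] : exists2 w, w \in m & w \notin P i1.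
  apply: contrapT => none; apply: nP21 => r /sP2m mr.
  by apply: contrapT => /negP nPr; apply: none; exists r.
case=> O [orderO herO].
apply: (order_not_hereditary max_m complR mx my nz_x _ orderO herO).
move=> a k r s.
exact: (tofrac_extend noethR max_m complR genm (primeP i1) Pz nz_z mw Pw nz_x).
Qed.
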